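(* Let $0<\alpha<1$ and $A=-\log(1-\alpha)$. Let $\{L(t), t\ge 0\}$ be the Lévy process (with $L(0)=0$) generated by the infinitely divisible logarithmic series distribution supported by $\{0,1,2,\ldots\}$, i.e. such that $$P(L(1)=k)=\frac{1}{A}\,\frac{\alpha^{k+1}}{k+1},\qquad k=0,1,2,\ldots .$$ Let $c_{\bullet}=(c_1,c_2,\ldots)$ with $c_k=\frac{k!}{k+1}$, and let $y_\bullet=(y_1,y_2,\ldots)$ with $$y_{n}=\sum_{k=1}^{n}(-1)^{k-1}(k-1)!\,B_{n,k}(c_{\bullet}).$$ Then the transition probability of the process is given, for all $t\ge 0$ and $n=0,1,2,\ldots$, by $$P(L(t)=n)=\left(\frac{\alpha}{A}\right)^{t}\frac{\alpha^{n}}{n!}\sum_{k=0}^{n}[t]_{k\downarrow}\,B_{n,k}(c_{\bullet}),$$ or equivalently by $$P(L(t)=n)=\left(\frac{\alpha}{A}\right)^{t}\frac{\alpha^{n}}{n!}\sum_{k=0}^{n}t^{k}\,B_{n,k}(y_{\bullet}).$$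
   Context: A Lévy process here has stationary independent increments and starts at $0$; its law is determined by the (infinitely divisible) law of its value at time $1$. The logarithmic series distribution on $\{0,1,2,\ldots\}$ displayed in the claim is known to be infinitely divisible. Falling factorial: $[t]_{k\downarrow}=t(t-1)\cdots(t-k+1)$, $[t]_{0\downarrow}=1$. Partial Bell polynomials: for a sequence $x_\bullet=(x_1,x_2,\ldots)$ and $1\le k\le n$, $$B_{n,k}(x_\bullet)=\sum \frac{n!\,x_1^{k_1}\cdots x_n^{k_n}}{k_1!(1!)^{k_1}\cdots k_n!(n!)^{k_n}},$$ the sum running over all nonnegative integer solutions $(k_1,\ldots,k_n)$ of $k_1+2k_2+\cdots+nk_n=n$, $k_1+\cdots+k_n=k$. Conventions: $B_{0,0}=1$, and $B_{n,0}=B_{0,k}=0$ for $n,k>0$. *)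

(* Defs.v *)
From HB Require Import structures.
From mathcomp Require Import all_boot all_order all_algebra.
From mathcomp Require Import all_classical all_reals all_analysis.
From mathcomp Require Import measurable_realfun.

Set Implicit Arguments.
Unset Strict Implicit.
Unset Printing Implicit Defensive.

Import Order.TTheory GRing.Theory Num.Theory.
Import numFieldNormedType.Exports.

Local Open Scope classical_set_scope.
Local Open Scope ring_scope.

(* The product rule over all measurable B already contains the product rule
   over every subfamily: take B i = setT outside of it. *)
Definition mutually_independent (d : measure_display) (T : measurableType d)
    (R : realType) (P : probability T R) (n : nat)
    (X : 'I_n -> {RV P >-> R}) : Prop :=
  forall B : 'I_n -> set R, (forall i, measurable (B i)) ->
    P (\bigcap_i (X i @^-1` B i)) = (\prod_(i < n) P (X i @^-1` B i))%E.

Arguments mutually_independent {d T R} P {n} X.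

(* The time set is [0, +oo[; the values of L at negative times are irrelevant.
   Every finite list of times t_0 < ... < t_n is the start of an increasing
   sequence, hence the form of the independence clause.
   Regularity is required only as continuity in probability, which is implied
   by (almost surely) cadlag paths together with stationarity of the
   increments. Without it the law of L 1 does not determine that of L t: add to
   L a discontinuous additive function of time vanishing at 1. *)
Record levy_process (d : measure_display) (T : measurableType d)
    (R : realType) (P : probability T R) (L : R -> {RV P >-> R}) : Prop := {
  levy_start : P (L 0 @^-1` [set 0]) = 1%E ;
  levy_independent_increments : forall (t : nat -> R) (n : nat),
    0 <= t 0%N -> increasing_seq t ->
    mutually_independent P (fun i : 'I_n => L (t i.+1) \- L (t i)) ;
  levy_stationary_increments : forall s h : R, 0 <= s -> 0 <= h ->
    forall B : set R, measurable B ->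
    distribution P (L (s + h) \- L s) B = distribution P (L h \- L 0) B ;
  levy_stochastic_continuity : forall t e : R, 0 <= t -> 0 < e ->
    P [set w | e < `|L s w - L t w|]
      @[s --> within [set s | 0 <= s] (nbhs t)] --> 0%E
}.

Definition real_falling_factorial (R : realType) (t : R) (k : nat) : R :=
  \prod_(i < k) (t - i%:R).

(* The sequence x_1, x_2, ... is given by x : nat -> R, with x 0 unused, and
   m i is the exponent k_(i+1) of x_(i+1). Every solution of
   k_1 + 2 k_2 + ... + n k_n = n satisfies k_j <= n, so that ranging over
   m : {ffun 'I_n -> 'I_n.+1} loses none. When n = 0 or k = 0 the formula gives
   the usual conventions B_(0,0) = 1 and B_(n,0) = B_(0,k) = 0 for n, k > 0. *)
Definition partial_bell (R : realType) (n k : nat) (x : nat -> R) : R :=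
  \sum_(m : {ffun 'I_n -> 'I_n.+1} |
          ((\sum_(i < n) i.+1 * m i)%N == n) && ((\sum_(i < n) m i)%N == k))
    n`!%:R * (\prod_(i < n) x i.+1 ^+ m i)
      / \prod_(i < n) ((m i)`!%:R * (i.+1)`!%:R ^+ m i).

(* Main.v *)
Require Import Defs.
From HB Require Import structures.
From mathcomp Require Import all_boot all_order all_algebra.
From mathcomp Require Import all_classical all_reals all_analysis.
From mathcomp Require Import measurable_realfun.
From mathcomp Require Import ring lra.

Import Order.TTheory GRing.Theory Num.Theory.
Import numFieldNormedType.Exports.

Local Open Scope classical_set_scope.
Local Open Scope ring_scope.

(* With u = sum_(j >= 1) c_j X^j / j!, the number B_(n,k)(c) k! / n! is the
   coefficient of X^n in u^k, so the two sums in the theorem are n! times the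
   coefficients of X^n in (1 + u)^t and in exp (t log (1 + u)), where
   log (1 + u) = sum_j y_j X^j / j!. Both expansions are polynomials in t that
   solve the same differential equation, hence agree, and the exponential form
   shows that g_t = (alpha / A)^t (1 + u(alpha X))^t is a semigroup, with g_1
   the generating function of L(1).
   If L(2s) is natural valued and vanishes with positive probability, then so
   does L(s), because L(2s) is the sum of two independent copies of L(s); its
   generating function is then the square root of that of L(2s) with positive
   constant term. So g_s is the generating function of L(s) for s = 2^-j,
   hence for all dyadic s > 0, hence for all s >= 0 by continuity in
   probability. *)

(** * Partial Bell polynomials as coefficients of powers *)

Lemma scalerMM (R : comNzRingType) (S : algType R) (a b : R) (u v : S) :
  (a *: u) * (b *: v) = (a * b) *: (u * v).
Proof. by rewrite -scalerAl -scalerAr scalerA. Qed.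

(** The exponential generating function of [x], with constant term 0, cut at degree [N] so as to be
    a polynomial. The cut does not affect the coefficients of its powers up to [X^N]
    ([egf_powE]). *)
Definition egf {R : realType} (N : nat) (x : nat -> R) : {poly R} :=
  \poly_(j < N.+1) (if j == 0%N then 0 else x j / j`!%:R).

Definition egf_pow {R : realType} (x : nat -> R) (k n : nat) : R :=
  (egf n x ^+ k)`_n.

Lemma coef_egf (R : realType) (x : nat -> R) (N j : nat) : (j <= N)%N ->
  (egf N x)`_j = if j == 0%N then 0 else x j / j`!%:R.
Proof. by move=> jN; rewrite coef_poly ltnS jN. Qed.

Lemma coef_exp_congr (R : nzRingType) (p q : {poly R}) (n k : nat) :
  (forall i, (i <= n)%N -> p`_i = q`_i) ->
  forall i, (i <= n)%N -> (p ^+ k)`_i = (q ^+ k)`_i.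
Proof.
move=> pq; elim: k => [|k IH] i ni; first by rewrite !expr0.
rewrite !exprS !coefM; apply: eq_bigr => j _.
by rewrite pq ?IH// ?(leq_trans _ ni) ?leq_subr// -ltnS.
Qed.

Lemma egf_powE (R : realType) (x : nat -> R) (N k n : nat) : (n <= N)%N ->
  (egf N x ^+ k)`_n = egf_pow x k n.
Proof.
move=> nN; apply: (@coef_exp_congr _ _ _ n) => // i ni.
by rewrite !coef_egf// (leq_trans ni).
Qed.

Lemma egf_pow0 (R : realType) (x : nat -> R) (n : nat) :
  egf_pow x 0 n = (n == 0%N)%:R.
Proof. by rewrite /egf_pow expr0 coef1. Qed.

Lemma egf_pow1 (R : realType) (x : nat -> R) (n : nat) :
  egf_pow x 1 n = if n == 0%N then 0 else x n / n`!%:R.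
Proof. by rewrite /egf_pow expr1 coef_egf. Qed.

Lemma egf_powD (R : realType) (x : nat -> R) (i j n : nat) :
  egf_pow x (i + j) n =
  \sum_(l < n.+1) egf_pow x i l * egf_pow x j (n - l).
Proof.
rewrite {1}/egf_pow exprD coefM; apply: eq_bigr => l _.
by rewrite !egf_powE ?leq_subr// -ltnS.
Qed.

(** The series has no constant term, so its [k]-th power is divisible by [X^k]. *)
Lemma egf_pow_gt (R : realType) (x : nat -> R) (k n : nat) : (n < k)%N ->
  egf_pow x k n = 0.
Proof.
elim: k n => // k IH n nk; rewrite -addn1 egf_powD big1// => l _.
have [ln|] := ltnP l n; first by rewrite IH ?mul0r// (leq_trans ln).
by rewrite -subn_eq0 => /eqP ->; rewrite egf_pow1 mulr0.
Qed.

(* The coefficient of X^n in sum_k a_k u^k, where u = sum_(j >= 1) x_j X^j / j!;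
   the powers u^k with k > n do not contribute. *)
Definition egf_comp {R : realType} {S : algType R} (x : nat -> R)
    (a : nat -> S) (n : nat) : S :=
  \sum_(k < n.+1) egf_pow x k n *: a k.

Lemma egf_comp_widen (R : realType) (S : algType R) (x : nat -> R)
    (a : nat -> S) (N n : nat) : (n <= N)%N ->
  egf_comp x a n = \sum_(k < N.+1) egf_pow x k n *: a k.
Proof.
move=> nN; rewrite /egf_comp.
rewrite (big_ord_widen N.+1 (fun k => egf_pow x k n *: a k))//.
rewrite big_mkcond; apply: eq_bigr => i _; case: ifPn => //.
by rewrite -leqNgt => ni; rewrite egf_pow_gt// scale0r.
Qed.

Lemma eq_egf_comp (R : realType) (S : algType R) (x : nat -> R)
    (a b : nat -> S) (n : nat) : a =1 b -> egf_comp x a n = egf_comp x b n.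
Proof. by move=> ab; apply: eq_bigr => i _; rewrite ab. Qed.

(** Substituting [u] for the variable respects products of power series, here a Cauchy product. Both
    sides are rewritten as a double sum over the powers [u^(i+j)]. *)
Lemma egf_comp_mul (R : realType) (S : algType R) (x : nat -> R)
    (a b : nat -> S) (n : nat) :
  \sum_(l < n.+1) egf_comp x a l * egf_comp x b (n - l) =
  egf_comp x (fun k => \sum_(i < k.+1) a i * b (k - i)%N) n.
Proof.
transitivity (\sum_(i < n.+1) \sum_(j < n.+1)
    egf_pow x (i + j) n *: (a i * b j)).
  under eq_bigr => l _.
    rewrite (@egf_comp_widen _ _ _ _ n) -1?ltnS//.
    rewrite (@egf_comp_widen _ _ _ b n) ?leq_subr// big_distrlr/=.
    over.
  rewrite exchange_big; apply: eq_bigr => i _ /=.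
  rewrite exchange_big; apply: eq_bigr => j _ /=.
  rewrite egf_powD scaler_suml; apply: eq_bigr => l _.
  exact: scalerMM.
rewrite /egf_comp; under [RHS]eq_bigr => k _.
  rewrite (big_ord_widen n.+1 (fun i => a i * b (k - i)%N))// big_mkcond.
  rewrite scaler_sumr; over.
rewrite [RHS]exchange_big; apply: eq_bigr => i _ /=.
(* The terms with [i + j > n] vanish by [egf_pow_gt]; the others are reindexed by [k = i + j]. *)
rewrite -(big_mkord xpredT (fun j => egf_pow x (i + j) n *: (a i * b j))).
rewrite (@big_cat_nat _ _ _ (n.+1 - i)%N)/= ?leq_subr//.
rewrite [X in _ + X]big_nat_cond [X in _ + X]big1 ?addr0; last first.
  move=> j /andP[/andP[+ _] _]; rewrite leq_subLR => ij.
  by rewrite egf_pow_gt ?scale0r.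
rewrite -(big_mkord xpredT
  (fun k => egf_pow x k n *: (if (i < k.+1)%N then a i * b (k - i)%N else 0))).
rewrite [RHS](@big_cat_nat _ _ _ i)/= ?(ltnW (ltn_ord i))//.
rewrite [X in _ = X + _]big_nat_cond [X in _ = X + _]big1 ?add0r; last first.
  by move=> k /andP[/andP[_ ki] _]; rewrite ltnS leqNgt ki scaler0.
apply/esym; rewrite -{1}(add0n (i : nat)) big_addn; apply: eq_bigr => j _.
by rewrite ltnS leq_addl addnK addnC.
Qed.

(* Expand the product over j of the truncated exponentials of z_j T and read off
   the coefficient of T^k. *)
Lemma multinomial_ffun (R : realType) (S : comAlgType R) (J M k : nat)
    (z : 'I_J -> S) : (k <= M)%N ->
  \sum_(m : {ffun 'I_J -> 'I_M.+1} | (\sum_(j < J) m j)%N == k)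
    \prod_(j < J) ((m j)`!%:R^-1 *: z j ^+ m j)
  = k`!%:R^-1 *: (\sum_(j < J) z j) ^+ k.
Proof.
move=> kM.
pose E j : {poly S} := \sum_(i < M.+1) ((i`!%:R^-1 *: z j ^+ i) *: 'X^i).
transitivity ((\prod_(j < J) E j)`_k).
  rewrite /E bigA_distr_bigA /= coef_sum big_mkcond; apply: eq_bigr => m _.
  have -> : \prod_(j < J) (((m j)`!%:R^-1 *: z j ^+ m j) *: 'X^(m j)) =
     (\prod_(j < J) ((m j)`!%:R^-1 *: z j ^+ m j)) *: 'X^(\sum_(j < J) m j)
       :> {poly S}.
    by rewrite scaler_prod prodrXr.
  by rewrite coefZ coefXn eq_sym; case: eqP => _; rewrite ?mulr1// mulr0.
elim: J z @E k kM => [|J IH] z E k kM.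
  by rewrite !big_ord0 coef1 expr0n; case: k kM => [|k] _;
    rewrite ?fact0 ?invr1 ?scale1r// scaler0.
rewrite !big_ord_recr /= coefM addrC exprDn scaler_sumr.
apply: eq_bigr => i _.
have ik : (i <= k)%N by rewrite -ltnS.
rewrite IH ?(leq_trans ik)//.
have -> : (E ord_max)`_(k - i) = (k - i)`!%:R^-1 *: z ord_max ^+ (k - i).
  rewrite /E coef_sum.
  have kiM : (k - i < M.+1)%N by rewrite ltnS (leq_trans (leq_subr _ _)).
  rewrite (bigD1 (Ordinal kiM))//= coefZ coefXn eqxx mulr1.
  rewrite big1 ?addr0// => j jne; rewrite coefZ coefXn.
  case: eqP => [kij|_]; last by rewrite mulr0.
  by case/eqP: jne; apply: val_inj.
rewrite scalerMM -scalerMnr scalerMnl [in LHS](mulrC (_ ^+ _)); congr (_ *: _).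
rewrite -(bin_fact ik) !natrM !invfM.
have binN0 : ('C(k, i)%:R : R) != 0 by rewrite pnatr_eq0 -lt0n bin_gt0.
by rewrite -[RHS]mulr_natl mulVKf.
Qed.

(** Expand the [k]-th power of a sum of monomials by the multinomial formula: the exponents [m] sum
    to [k], and reading off [X^n] imposes the weight condition. As [k <= n], exponents up to [n]
    suffice. *)
Lemma partial_bellE (R : realType) (n k : nat) (x : nat -> R) : (k <= n)%N ->
  partial_bell n k x = n`!%:R / k`!%:R * egf_pow x k n.
Proof.
move=> kn; rewrite /egf_pow.
pose z (i : 'I_n) : {poly R} := (x i.+1 / (i.+1)`!%:R) *: 'X^(i.+1).
have -> : egf n x = \sum_(i < n) z i.
  rewrite /egf poly_def big_ord_recl /= scale0r add0r.
  by [].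
rewrite -mulrA -coefZ -(@multinomial_ffun _ _ _ n)// coef_sum mulr_sumr.
rewrite /partial_bell big_mkcondl; apply: eq_bigr => m _.
have -> : \prod_(j < n) ((m j)`!%:R^-1 *: z j ^+ m j) =
    (\prod_(j < n) ((m j)`!%:R^-1 * (x j.+1 / (j.+1)`!%:R) ^+ m j)) *:
    'X^(\sum_(j < n) j.+1 * m j).
  rewrite -prodrXr -scaler_prod; apply: eq_bigr => j _.
  by rewrite /z exprZn -exprM scalerA.
rewrite coefZ coefXn eq_sym; case: eqP => _; rewrite ?mulr0//= mulr1.
rewrite -mulrA; congr (_ * _); rewrite -prodf_div; apply: eq_bigr => j _.
by rewrite expr_div_n invfM mulrCA mulrA.
Qed.

(** * Binomial and exponential series *)

(** The polynomial [t choose k], the coefficient of [X^k] in [(1 + X)^t]. *)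
Definition binomial_poly {R : realType} (k : nat) : {poly R} :=
  k`!%:R^-1 *: \prod_(i < k) ('X - i%:R%:P).

Lemma horner_binomial_poly (R : realType) (k : nat) (t : R) :
  (binomial_poly k).[t] = real_falling_factorial t k / k`!%:R.
Proof.
rewrite hornerZ horner_prod mulrC; congr (_ * _).
by apply: eq_bigr => i _; rewrite !hornerE.
Qed.

Lemma binomial_polyS (R : realType) (k : nat) :
  k.+1%:R *: binomial_poly k.+1 = ('X - k%:R%:P) * binomial_poly k :> {poly R}.
Proof.
rewrite /binomial_poly big_ord_recr/= scalerA factS natrM invfM.
rewrite mulVKf ?pnatr_eq0//.
by rewrite -scalerAr mulrC.
Qed.

(* The coefficients of log (1 + X); the one of X^0 is 0 because 0^-1 = 0. *)
Definition log1p_coef {R : realType} (i : nat) : R := (-1) ^+ i.-1 / i%:R.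

Lemma log1p_coef0 (R : realType) : log1p_coef 0 = 0 :> R.
Proof. by rewrite /log1p_coef invr0 mulr0. Qed.

(** The coefficient of [X^k] in [d/dt (1 + X)^t = log (1 + X) (1 + X)^t], by induction through the
    recurrence [binomial_polyS]. *)
Lemma deriv_binomial_poly (R : realType) (k : nat) :
  (binomial_poly k)^`() =
  \sum_(i < k.+1) log1p_coef i *: binomial_poly (k - i) :> {poly R}.
Proof.
elim: k => [|k IH].
  rewrite /binomial_poly big_ord1 big_ord0 log1p_coef0 scale0r.
  by rewrite derivZ derivC scaler0.
have kN0 : (k.+1%:R : R) != 0 by rewrite pnatr_eq0.
apply: (scalerI kN0); rewrite -derivZ binomial_polyS derivM IH.
rewrite derivB derivX derivC subr0 mul1r.
rewrite mulr_sumr scaler_sumr.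
(* Split [k+1 = i + (k+1-i)]: the first part cancels the denominator in [log1p_coef i], the second
   calls for the recurrence again. *)
have -> : \sum_(i < k.+2) k.+1%:R *: (log1p_coef i *: binomial_poly (k.+1 - i)) =
    \sum_(i < k.+2) (i%:R * log1p_coef i) *: binomial_poly (k.+1 - i) +
    \sum_(i < k.+2) log1p_coef i *:
      ((k.+1 - i)%:R *: binomial_poly (k.+1 - i)) :> {poly R}.
  rewrite -big_split; apply: eq_bigr => i _ /=.
  rewrite scalerA [X in _ = _ + X]scalerA -scalerDl; congr (_ *: _).
  by rewrite [i%:R * _]mulrC -mulrDr -natrD subnKC -1?ltnS// mulrC.
rewrite [X in _ = X + _]big_ord_recl /= mul0r scale0r add0r.
rewrite [X in _ = _ + X]big_ord_recr /= subnn scale0r scaler0 addr0.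
(* For [i >= 1] the factor is [(-1)^(i-1)], so this is [X/(1+X) = X - X (X/(1+X))] multiplied by
   [(1 + X)^t]. *)
have H1 : \sum_(i < k.+1) ((bump 0 i)%:R * log1p_coef (bump 0 i)) *:
      binomial_poly (k.+1 - bump 0 i) =
    binomial_poly k - \sum_(i < k.+1) (i%:R * log1p_coef i) *:
      binomial_poly (k - i) :> {poly R}.
  rewrite !big_ord_recl /= mul0r scale0r add0r.
  rewrite /log1p_coef /bump /= expr0 mul1r mulfV// scale1r subn1 -sumrN.
  congr (_ + _); apply: eq_bigr => i _; rewrite !add1n /= subSS.
  rewrite [_ * (_ / _)]mulrC mulfVK ?pnatr_eq0//.
  by rewrite [_ * (_ / _)]mulrC mulfVK ?pnatr_eq0// exprS mulN1r scaleNr.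
rewrite H1 -addrA; congr (_ + _).
rewrite addrC -sumrB; apply: eq_bigr => i _.
have ik : (i <= k)%N by rewrite -ltnS.
rewrite subSn// binomial_polyS -scalerAr [i%:R * _]mulrC.
move: (log1p_coef i) (binomial_poly _) => a b.
rewrite -scalerA -scalerBr; congr (_ *: _).
rewrite -mul_polyC -mulrBl; congr (_ * _).
by rewrite natrB// polyCB opprB addrA addrAC addrK.
Qed.

Lemma horner_binomial_poly0 (R : realType) (k : nat) :
  (binomial_poly k).[0 : R] = (k == 0%N)%:R.
Proof.
rewrite horner_binomial_poly /real_falling_factorial.
case: k => [|k]; first by rewrite big_ord0 divr1.
by rewrite big_ord_recl subrr !mul0r.
Qed.

Lemma deriv_horner0_inj (R : realType) (p q : {poly R}) :
  p^`() = q^`() -> p.[0] = q.[0] -> p = q.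
Proof.
move=> dpq pq0; apply/polyP => -[|i]; first by rewrite -!horner_coef0.
have := congr1 (fun r : {poly R} => r`_i) dpq; rewrite !coef_deriv.
by apply: pmulrnI.
Qed.

Lemma horner_egf_comp (R : realType) (x : nat -> R) (a : nat -> {poly R})
    (n : nat) (t : R) :
  (egf_comp x a n).[t] = egf_comp x ((fun k => (a k).[t]) : nat -> R^o) n.
Proof.
by rewrite /egf_comp horner_sum; apply: eq_bigr => k _; rewrite hornerZ.
Qed.

(** Substitution of [u] in [deriv_binomial_poly], which [egf_comp_mul] permits: the equation
    satisfied by [(1 + u)^t]. *)
Lemma egf_comp_binomial_deriv (R : realType) (c : nat -> R) (n : nat) :
  (egf_comp c binomial_poly n)^`() =
  \sum_(l < n.+1) (egf_comp c (log1p_coef : nat -> R^o) l)%:P *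
    egf_comp c binomial_poly (n - l).
Proof.
transitivity (\sum_(l < n.+1) egf_comp c (fun i => (log1p_coef i)%:P) l *
    egf_comp c binomial_poly (n - l)); last first.
  apply: eq_bigr => l _; congr (_ * _).
  rewrite /egf_comp rmorph_sum; apply: eq_bigr => i _ /=.
  by rewrite -mul_polyC -polyCM.
rewrite egf_comp_mul /egf_comp raddf_sum; apply: eq_bigr => k _ /=.
rewrite derivZ deriv_binomial_poly; congr (_ *: _); apply: eq_bigr => i _.
by rewrite mul_polyC.
Qed.

Definition exp_poly {R : realType} (k : nat) : {poly R} := k`!%:R^-1 *: 'X^k.

(** From [d/dt exp (t X) = X exp (t X)]; the factor [X] is written as a coefficient sequence so that
    [egf_comp_mul] applies. *)
Lemma deriv_exp_poly (R : realType) (k : nat) :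
  (exp_poly k)^`() =
  \sum_(i < k.+1) (i == 1%N :> nat)%:R *: exp_poly (k - i) :> {poly R}.
Proof.
rewrite derivZ derivXn big_ord_recl scale0r add0r.
case: k => [|k]; first by rewrite big_ord0 mulr0n scaler0.
rewrite big_ord_recl /= scale1r big1 ?addr0.
  rewrite /exp_poly subn1 -scalerMnr scalerMnl factS natrM invfM -mulr_natl.
  by rewrite mulVKf ?pnatr_eq0.
by move=> i _; rewrite scale0r.
Qed.

Lemma egf_comp_exp_deriv (R : realType) (y : nat -> R) (n : nat) :
  (egf_comp y exp_poly n)^`() =
  \sum_(l < n.+1) (egf_pow y 1 l)%:P * egf_comp y exp_poly (n - l).
Proof.
transitivity (\sum_(l < n.+1)
    egf_comp y (fun i => ((i == 1%N)%:R%:P : {poly R})) l *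
    egf_comp y exp_poly (n - l)); last first.
  apply: eq_bigr => l _; congr (_ * _).
  rewrite (@egf_comp_widen _ _ _ _ l.+1)// 2!big_ord_recl big1 => [|i _].
    by rewrite /= scaler0 add0r addr0 -mul_polyC mulr1.
  by rewrite /= scaler0.
rewrite egf_comp_mul /egf_comp raddf_sum; apply: eq_bigr => k _ /=.
rewrite derivZ deriv_exp_poly; congr (_ *: _); apply: eq_bigr => i _.
by rewrite mul_polyC.
Qed.

(* [(1 + u)^t = exp (t log (1 + u))] *)
Lemma egf_comp_binomial_exp (R : realType) (c y : nat -> R) (n : nat) :
  (forall n, (1 <= n)%N ->
     y n = n`!%:R * egf_comp c (log1p_coef : nat -> R^o) n) ->
  egf_comp c binomial_poly n = egf_comp y exp_poly n.
Proof.
move=> yE.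
have lam l : egf_comp c (log1p_coef : nat -> R^o) l = egf_pow y 1 l.
  rewrite egf_pow1; case: l => [|l].
    by rewrite /egf_comp big_ord1 log1p_coef0 scaler0.
  by rewrite yE//= mulrC mulKf// pnatr_eq0 -lt0n fact_gt0.
elim/ltn_ind: n => n IH; apply: deriv_horner0_inj.
  rewrite egf_comp_binomial_deriv egf_comp_exp_deriv.
  (* [log (1 + u)] has no constant term, so only indices below [n] contribute and the induction
     hypothesis applies. *)
  apply: eq_bigr => -[[|l] ln] _ /=; rewrite lam; last first.
    by rewrite IH// ltn_subrL; apply: (@leq_trans l.+1).
  by rewrite egf_pow1 polyC0 !mul0r.
(* At [t = 0] both series are the constant 1. *)
have at0 x (a : nat -> {poly R}) :
    (forall k, (a k).[0] = (k == 0%N)%:R) -> (egf_comp x a n).[0] = (n == 0%N)%:R.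
  move=> a0; rewrite horner_egf_comp /egf_comp big_ord_recl big1 => [|i _].
    by rewrite addr0 a0 egf_pow0 [LHS]mulr1.
  by rewrite a0 scaler0.
rewrite !at0// => k; first by rewrite hornerZ hornerXn; case: k => [|k];
  rewrite ?expr0n ?mulr0// fact0 invr1 mul1r.
exact: horner_binomial_poly0.
Qed.

(** Coefficients of [exp (s v) exp (t v) = exp ((s + t) v)], with [v] the series of [y];
    [egf_comp_mul] reduces it to the binomial theorem. *)
Lemma egf_comp_expD (R : realType) (y : nat -> R) (n : nat) (s t : R) :
  \sum_(l < n.+1) (egf_comp y exp_poly l).[s] * (egf_comp y exp_poly (n - l)).[t]
  = (egf_comp y exp_poly n).[s + t].
Proof.
under eq_bigr do rewrite !horner_egf_comp.
rewrite horner_egf_comp egf_comp_mul; apply: eq_egf_comp => k.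
rewrite /exp_poly hornerZ hornerXn addrC exprDn mulr_sumr; apply: eq_bigr => i _.
have ik : (i <= k)%N by rewrite -ltnS.
rewrite !hornerZ !hornerXn -(bin_fact ik) !natrM !invfM.
have binN0 : ('C(k, i)%:R : R) != 0 by rewrite pnatr_eq0 -lt0n bin_gt0.
rewrite -[(_ * _) *+ _]mulr_natl.
by rewrite [RHS]mulrACA mulVf// mul1r mulrACA [t ^+ _ * _]mulrC.
Qed.

(** The [1/k!] of [partial_bellE] turns weights into series coefficients: falling factorials lead to
    [(1 + u)^t], powers of [t] to an exponential. *)
Lemma sum_partial_bell (R : realType) (x : nat -> R) (f : nat -> R)
    (a : nat -> {poly R}) (t : R) (n : nat) :
  (forall k, (a k).[t] = f k / k`!%:R) ->
  \sum_(0 <= k < n.+1) f k * partial_bell n k x =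
  n`!%:R * (egf_comp x a n).[t].
Proof.
move=> fa; rewrite big_mkord horner_egf_comp mulr_sumr; apply: eq_bigr => k _.
rewrite partial_bellE -1?ltnS// fa mulrCA -!mulrA; congr (_ * _).
by rewrite /GRing.scale /=; ring.
Qed.

(** As [(k-1)!/k! = 1/k], the weights become the coefficients of the logarithm. *)
Lemma sum_log_partial_bell (R : realType) (c : nat -> R) (n : nat) :
  \sum_(1 <= k < n.+1) (-1) ^+ k.-1 * (k.-1)`!%:R * partial_bell n k c =
  n`!%:R * egf_comp c (log1p_coef : nat -> R^o) n.
Proof.
rewrite /egf_comp.
rewrite -(big_mkord xpredT (fun k => egf_pow c k n *: (log1p_coef k : R^o))).
rewrite big_nat_recl// log1p_coef0 scaler0 add0r big_add1 /=.
rewrite mulr_sumr !big_mkord; apply: eq_bigr => k _.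
rewrite partial_bellE//= factS natrM invfM /log1p_coef /=.
have k0 : (k`!%:R : R) != 0 by rewrite pnatr_eq0 -lt0n fact_gt0.
by rewrite /GRing.scale /=; set v := k.+1%:R^-1; field.
Qed.

(** * Laws of Levy processes *)

Definition natset {R : realType} : set R := \bigcup_k [set k%:R].

Lemma measurable_natset (R : realType) : measurable (@natset R).
Proof. exact: bigcupT_measurable. Qed.

Section null_sets.
Context {d : measure_display} {T : measurableType d} {R : realType}.
Context {P : probability T R}.
Implicit Types E F N : set T.

Lemma le_probability_null E F N :
  measurable E -> measurable F -> measurable N ->
  P N = 0%E -> E `<=` F `|` N -> (P E <= P F)%E.
Proof.
move=> mE mF mN N0 EFN.
rewrite -(adde0 (P F)) -N0; apply: le_trans (measureU2 _ mF mN).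
by apply: le_measure; rewrite ?inE//; exact: measurableU.
Qed.

Lemma eq_probability_null E F N :
  measurable E -> measurable F -> measurable N -> P N = 0%E ->
  (forall w, ~ N w -> E w <-> F w) -> P E = P F.
Proof.
move=> mE mF mN N0 EF; apply/eqP; rewrite eq_le; apply/andP; split;
  apply: le_probability_null N0 _ => // w;
  by have [Nw|/EF[EFw FEw]] := pselect (N w); [right|left; auto].
Qed.

Lemma probability_setU_null E F : measurable E -> measurable F ->
  P E = 0%E -> P F = 0%E -> P (E `|` F) = 0%E.
Proof.
by move=> mE mF E0 F0; rewrite measureU0.
Qed.

Lemma probability_sub_null E N : measurable E -> measurable N ->
  P N = 0%E -> E `<=` N -> P E = 0%E.
Proof.
move=> mE mN N0 EN; apply/eqP; rewrite -measure_le0 -N0.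
by apply: le_measure; rewrite ?inE.
Qed.

End null_sets.

Section levy_law.
Context {d : measure_display} {T : measurableType d} {R : realType}.
Context {P : probability T R} {L : R -> {RV P >-> R}}.
Context (levyL : levy_process L).
Implicit Types (s t h : R) (A B C : set R).

Let start0 : P (L 0 @^-1` (~` [set 0])) = 0%E.
Proof.
rewrite -preimage_setC probability_setC; last exact: measurable_funPTI.
by rewrite (levy_start levyL) subee.
Qed.

Let m0 : measurable (L 0 @^-1` (~` [set 0])).
Proof. by apply: measurable_funPTI; exact: measurableC. Qed.

Lemma levy_increment_law (s h : R) A : 0 <= s -> 0 <= h -> measurable A ->
  P ((L (s + h) \- L s) @^-1` A) = P (L h @^-1` A).
Proof.
move=> s0 h0 mA.
have -> : P ((L (s + h) \- L s) @^-1` A) = P ((L h \- L 0) @^-1` A).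
  exact: (levy_stationary_increments levyL).
apply: (eq_probability_null _ _ _ _ _ m0 start0); [exact: measurable_funPTI..|].
by move=> w /= /contrapT L0; rewrite L0 subr0.
Qed.

Lemma levy_two_increments (s h : R) A B : 0 < s -> 0 < h ->
  measurable A -> measurable B ->
  P (L s @^-1` A `&` (L (s + h) \- L s) @^-1` B) =
  (P (L s @^-1` A) * P (L h @^-1` B))%E.
Proof.
move=> s0 h0 mA mB.
(* Independence is stated along an increasing sequence; [0, s, s+h, s+2h, ...] prolongs the three
   times that matter. *)
pose t (n : nat) : R := if n is n'.+1 then s + n'%:R * h else 0.
have t_incr : increasing_seq t.
  apply/increasing_seqP => -[|n] /=; first by rewrite mul0r addr0.
  by rewrite ltrD2l ltr_pM2r// ltr_nat.
pose D (i : 'I_2) := if i == ord0 then A else B.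
have mD i : measurable (D i) by rewrite /D; case: ifP.
have := levy_independent_increments levyL (n := 2) (lexx 0) t_incr mD.
rewrite big_ord_recl big_ord1 /D /=.
rewrite mul0r addr0 mul1r => ind.
have eqA : P ((L s \- L 0) @^-1` A) = P (L s @^-1` A).
  by rewrite -{1}(add0r s) levy_increment_law// ltW.
have eqB : P ((L (s + h) \- L s) @^-1` B) = P (L h @^-1` B).
  by rewrite levy_increment_law// ltW.
rewrite -eqA -eqB -ind.
have mI (f g : {RV P >-> R}) (A' B' : set R) : measurable A' -> measurable B' ->
    measurable (f @^-1` A' `&` g @^-1` B').
  by move=> mA' mB'; apply: measurableI; exact: measurable_funPTI.
transitivity (P ((L s \- L 0) @^-1` A `&` (L (s + h) \- L s) @^-1` B)).
  apply: (eq_probability_null _ _ _ _ _ m0 start0); [exact: mI..|].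
  by move=> w /= /contrapT L0; rewrite L0 subr0.
congr (P _); apply/seteqP; split => w /=.
  by move=> [wA wB] [[|[|//]] i2] _ /=; rewrite ?mul0r ?addr0 ?mul1r.
move=> wAB; split.
  by have /= := wAB ord0 I; rewrite mul0r addr0.
by have /= := wAB (lift ord0 ord0) I; rewrite mul1r mul0r addr0.
Qed.

Lemma levy_superadditive (s h : R) A B C : 0 < s -> 0 < h ->
  measurable A -> measurable B -> measurable C ->
  (forall x y, A x -> B y -> C (x + y)) ->
  (P (L s @^-1` A) * P (L h @^-1` B) <= P (L (s + h) @^-1` C))%E.
Proof.
move=> s0 h0 mA mB mC ABC; rewrite -levy_two_increments//.
apply: le_measure; rewrite ?inE.
- by apply: measurableI; exact: measurable_funPTI.
- exact: measurable_funPTI.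
- move=> w /= [wA wB]; rewrite -(subrK (L s w) (L (s + h) w)) addrC.
  exact: ABC.
Qed.

Definition nat_valued (s : R) := P (L s @^-1` (~` natset)) = 0%E.

Let mN (s : R) : measurable (L s @^-1` (~` natset)).
Proof.
by apply: measurable_funPTI; apply: measurableC; exact: measurable_natset.
Qed.

Let mNN (s h : R) : measurable
  (L s @^-1` (~` natset) `|` (L (s + h) \- L s) @^-1` (~` natset)).
Proof.
apply: measurableU => //.
by apply: measurable_funPTI; apply: measurableC; exact: measurable_natset.
Qed.

Let NN0 (s h : R) : 0 < s -> 0 < h -> nat_valued s -> nat_valued h ->
  P (L s @^-1` (~` natset) `|` (L (s + h) \- L s) @^-1` (~` natset)) = 0%E.
Proof.
move=> s0 h0 Ns Nh; apply: probability_setU_null => //.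
  by apply: measurable_funPTI; apply: measurableC; exact: measurable_natset.
rewrite levy_increment_law ?ltW//.
by apply: measurableC; exact: measurable_natset.
Qed.

Lemma nat_valuedD (s h : R) : 0 < s -> 0 < h ->
  nat_valued s -> nat_valued h -> nat_valued (s + h).
Proof.
move=> s0 h0 Ns Nh.
apply: (probability_sub_null _ _ (mN _) (mNN s h) (NN0 s h s0 h0 Ns Nh)).
move=> w /= wN; apply: contrapT => /not_orP[/contrapT[i _ wi] /contrapT[j _ wj]].
by apply: wN; exists (i + j)%N => //=; rewrite natrD -wi -wj [RHS]addrC subrK.
Qed.

(** Split according to the value of [L s]. Off the null event where [L s] or the increment is not
    natural, [L (s + h) = n] forces values [i] and [n - i]. *)
Lemma levy_convolution (s h : R) (n : nat) : 0 < s -> 0 < h ->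
  nat_valued s -> nat_valued h ->
  P (L (s + h) @^-1` [set n%:R]) =
  (\sum_(i < n.+1) P (L s @^-1` [set i%:R]) * P (L h @^-1` [set (n - i)%:R]))%E.
Proof.
move=> s0 h0 Ns Nh.
pose F (i : 'I_n.+1) := L s @^-1` [set i%:R] `&`
  (L (s + h) \- L s) @^-1` [set (n - i)%:R].
have mF i : measurable (F i).
  by apply: measurableI; exact: measurable_funPTI.
under eq_bigr => i _ do rewrite -levy_two_increments//.
rewrite -(@measure_bigsetU_ord _ _ _ _ _ xpredT F)//; last first.
  apply/trivIsetP => i j _ _ /eqP ij; rewrite -subset0 => w [[/= wi _] [/= wj _]].
  apply: ij; apply: val_inj; apply/eqP.
  by rewrite -(eqr_nat R) -wi -wj.
apply: (eq_probability_null _ _ _ _ _ (mNN s h) (NN0 s h s0 h0 Ns Nh)).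
- exact: measurable_funPTI.
- by apply: bigsetU_measurable => i _; exact: mF.
move=> w /= /not_orP[/contrapT[i _ wi] /contrapT[j _ wj]].
rewrite -bigcup_mkord_ord; split => [wn|[k /= kn [/=]]].
  have ijn : (i + j)%N = n.
    by apply/eqP; rewrite -(eqr_nat R) natrD -wi -wj -wn [X in X == _]addrC subrK.
  have ltin : (i < n.+1)%N by rewrite ltnS -ijn leq_addr.
  by exists i => //; split; rewrite /= inordK//; rewrite -ijn addKn.
rewrite inordK// => wk wnk.
by rewrite -(subrK (L s w) (L (s + h) w)) wnk wk -natrD subnK.
Qed.

Lemma nat_valued_half (s : R) : 0 < s -> nat_valued (s + s) ->
  P (L (s + s) @^-1` [set 0]) != 0%E ->
  nat_valued s /\ P (L s @^-1` [set 0]) != 0%E.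
Proof.
move=> s0 N2s P2s.
pose neg : set R := [set x | x < 0].
have mneg : measurable neg.
  by have -> : neg = [set` `]-oo, 0[] by []; exact: measurable_itv.
(* If [L s] and the independent increment are both negative, so is [L (s + s)]; hence the square of
   this probability is 0. *)
have neg0 : P (L s @^-1` neg) = 0%E.
  have PP : (P (L s @^-1` neg) * P (L s @^-1` neg) = 0)%E.
    apply/eqP; rewrite eq_le; apply/andP; split; last by rewrite mule_ge0.
    rewrite -N2s; apply: levy_superadditive => //.
      by apply: measurableC; exact: measurable_natset.
    by move=> x y; rewrite /neg /= => x0 y0 [k _ /= xyk]; move: (ler0n R k); lra.
  by move/eqP: PP; rewrite mule_eq0 orbb => /eqP.
(* Two almost surely nonnegative terms with sum 0 are both 0, so [L s = 0] cannot be null. *)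
have P0 : P (L s @^-1` [set 0]) != 0%E.
  apply: contra_neq P2s => Ps0.
  have mS C : measurable C -> measurable (L s @^-1` C).
    exact: measurable_funPTI.
  have mD C : measurable C -> measurable ((L (s + s) \- L s) @^-1` C).
    exact: measurable_funPTI.
  apply: (@probability_sub_null _ _ _ _ _ (L s @^-1` neg `|`
    (L (s + s) \- L s) @^-1` neg `|` L s @^-1` [set 0])).
  - exact: measurable_funPTI.
  - by apply: measurableU; [apply: measurableU; [exact: mS|exact: mD]|exact: mS].
  - apply: probability_setU_null Ps0; [|exact: mS|].
      by apply: measurableU; [exact: mS|exact: mD].
    apply: (probability_setU_null _ _ _ _ neg0); [exact: mS|exact: mD|].
    by rewrite levy_increment_law ?ltW.
  - move=> w /= w0; have [|lt0] := ltP (L s w) 0; first by left; left.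
    have [|lt0'] := ltP (L (s + s) w - L s w) 0; first by left; right.
    by right => /=; lra.
split=> //.
(* A non-natural [L s] followed by a zero increment gives a non-natural [L (s + s)]. *)
have PP : (P (L s @^-1` (~` natset)) * P (L s @^-1` [set 0%R]) = 0)%E.
  apply/eqP; rewrite eq_le; apply/andP; split; last by rewrite mule_ge0.
  have mNat : measurable (~` (@natset R)).
    by apply: measurableC; exact: measurable_natset.
  rewrite -N2s; apply: levy_superadditive => //.
  by move=> x y /= Nx ->; rewrite addr0.
by move/eqP: PP; rewrite mule_eq0 (negPf P0) orbF => /eqP.
Qed.

(** Convergence in probability alone need not preserve point masses. Here the [L (u j)] live on the
    naturals, so the mass at [n] can be compared with that of a small ball around [n], which is then
    shrunk. *)
Lemma levy_law_limit (t g : R) (u G : nat -> R) (n : nat) :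
  0 <= t -> (forall j, 0 <= u j) -> u @ \oo --> t -> G @ \oo --> g ->
  (forall j, nat_valued (u j)) ->
  (forall j, P (L (u j) @^-1` [set n%:R]) = (G j)%:E) ->
  P (L t @^-1` [set n%:R]) = g%:E.
Proof.
move=> t0 u0 ut Gg Nu PG.
pose B (e : R) : set R := [set x | `|x - n%:R| <= e].
have mB e : measurable (B e).
  have -> : B e = [set` `[n%:R - e, n%:R + e]].
    by apply/seteqP; split=> x; rewrite /B /= in_itv/= ler_distl.
  exact: measurable_itv.
have PB e : 0 < e -> e < 2^-1 -> P (L t @^-1` B e) = g%:E.
  move=> e0 e1.
  pose D : set R := [set x | e < `|x|].
  have mD : measurable D.
    have -> : D = ~` [set` `[- e, e]].
      apply/seteqP; split=> x; rewrite /D /= in_itv/= -ler_norml ltNge;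
        by move/negP.
    by apply: measurableC; exact: measurable_itv.
  pose Q j := P ((L (u j) \- L t) @^-1` D).
  have mQ j : measurable ((L (u j) \- L t) @^-1` D).
    exact: measurable_funPTI.
  have mS s A : measurable A -> measurable (L s @^-1` A).
    exact: measurable_funPTI.
  have Q0 : fine \o Q @ \oo --> (0 : R).
    apply: fine_cvg.
    have uw : u @ \oo --> within [set s | 0 <= s] (nbhs t).
      move=> A hA.
      have : \forall j \near \oo, 0 <= u j -> A (u j) by exact: ut hA.
      by apply: filterS => j; apply; exact: u0.
    have sc := levy_stochastic_continuity levyL t0 e0.
    exact: (@cvg_comp _ _ _ u (fun s => P ((L s \- L t) @^-1` D)) _ _ _ uw sc).
  (* If [L t] is within [e] of [n] and [L (u j)] within [e] of [L t], then the natural number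
     [L (u j)] is at distance at most [2e < 1] from [n], hence equal to it. *)
  have upper j : (P (L t @^-1` B e) <= (G j)%:E + Q j)%E.
    rewrite -PG.
    apply: (@le_trans _ _ (P (L (u j) @^-1` [set n%:R] `|`
      (L (u j) \- L t) @^-1` D))); last exact: measureU2.
    apply: (le_probability_null _ _ _ _ _ _ (Nu j)) => //.
    - exact: mS.
    - by apply: measurableU => //; exact: mS.
    move=> w; rewrite /B /= => wB.
    have [De|De] := ltP e `|L (u j) w - L t w|; first by left; right.
    have [[k _ /= wk]|] := pselect (natset (L (u j) w)); last by right.
    left; left => /=; rewrite wk; apply/eqP; rewrite eqr_nat.
    have : `|k%:R - n%:R| < 1 :> R.
      rewrite -wk; apply: (@le_lt_trans _ _ (e + e)); last by lra.
      by apply: le_trans (lerD De wB); apply: le_trans (ler_normD _ _);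
        rewrite addrA subrK.
    case: ltngtP => // kn.
    + rewrite distrC -natrB ?(ltnW kn)// normr_nat (ltr_nat R _ 1).
      by rewrite ltnS leqn0 subn_eq0 leqNgt kn.
    + rewrite -natrB ?(ltnW kn)// normr_nat (ltr_nat R _ 1).
      by rewrite ltnS leqn0 subn_eq0 leqNgt kn.
  have lower j : ((G j)%:E <= P (L t @^-1` B e) + Q j)%E.
    rewrite -PG.
    apply: (@le_trans _ _ (P (L t @^-1` B e `|`
      (L (u j) \- L t) @^-1` D))); last by apply: measureU2 => //; exact: mS.
    apply: le_measure; rewrite ?inE.
    - exact: mS.
    - by apply: measurableU => //; exact: mS.
    move=> w /= wn; rewrite /B /=.
    have [De|De] := ltP e `|L (u j) w - L t w|; first by right.
    by left; rewrite distrC -wn.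
  have Pfin (E : set T) : measurable E -> P E \is a fin_num by exact: fin_num_measure.
  have PBE : P (L t @^-1` B e) = (fine (P (L t @^-1` B e)))%:E.
    by rewrite fineK// Pfin//; exact: mS.
  have QE j : Q j = (fine (Q j))%:E by rewrite fineK// Pfin.
  rewrite PBE; congr (_%:E); set a := fine _.
  suff Ga : G @ \oo --> a by exact: (cvg_unique _ Ga Gg).
  have : (fun j => a - fine (Q j)) @ \oo --> a.
    by rewrite -[X in _ --> X]subr0; apply: cvgB Q0; exact: cvg_cst.
  have : (fun j => a + fine (Q j)) @ \oo --> a.
    by rewrite -[X in _ --> X]addr0; apply: cvgD Q0; exact: cvg_cst.
  move=> c1 c2; apply: squeeze_cvgr c2 c1; near=> j.
  have := upper j; have := lower j; rewrite PBE QE -!EFinD !lee_fin -/a.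
  by move=> l1 l2; apply/andP; split; lra.
(* The radii [1/(k+3)] are all below [1/2]. *)
pose F k := L t @^-1` B (k.+3%:R^-1).
have mF k : measurable (F k) by exact: measurable_funPTI.
have capF : \bigcap_k F k = L t @^-1` [set n%:R].
  apply/seteqP; split => w; last first.
    by move=> /= wn k _; rewrite /F /B /= wn subrr normr0.
  move=> wF; apply/eqP/negPn/negP => wn.
  have y0 : 0 < `|L t w - n%:R| by rewrite normr_gt0 subr_eq0.
  have := wF (Num.truncn `|L t w - n%:R|^-1) I; rewrite /F /B /=.
  apply/negP; rewrite -ltNge -[ltRHS]invrK ltf_pV2 ?posrE ?invr_gt0//.
  by rewrite (lt_le_trans (truncnS_gt _))// ler_nat ltnS -addn2 leq_addr.
have niF : nonincreasing_seq F.
  move=> i j ij; apply/subsetPset => w; rewrite /F /B /= => /le_trans; apply.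
  by rewrite lef_pV2 ?posrE// ler_nat.
have PF k : P (F k) = g%:E.
  apply: PB; first by rewrite invr_gt0.
  by rewrite ltf_pV2 ?posrE// ltr_nat.
have F0oo : (P (F 0%N) < +oo)%E by rewrite PF ltry.
have mcap : measurable (\bigcap_k F k) by rewrite capF; exact: measurable_funPTI.
have := nonincreasing_cvg_mu F0oo mF mcap niF; rewrite capF => PFn.
have PFg : (fun k => P (F k)) @ \oo --> g%:E.
  by under eq_fun do rewrite PF; exact: cvg_cst.
exact: (cvg_unique (@ereal_hausdorff R) PFn PFg).
Unshelve. all: by end_near. Qed.

End levy_law.

(** A power series has at most one square root with positive constant term: coefficient [n+1] of the
    square is [2 a_0 a_(n+1)] plus terms in lower coefficients. *)
Lemma convolution_sqrt_unique (R : realFieldType) (a b : nat -> R) :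
  0 < a 0%N -> 0 < b 0%N ->
  (forall n, \sum_(i < n.+1) a i * a (n - i)%N =
             \sum_(i < n.+1) b i * b (n - i)%N) ->
  a =1 b.
Proof.
move=> a0 b0 ab; elim/ltn_ind => -[_|n IH].
  have := ab 0%N; rewrite !big_ord1 -!expr2 => /eqP.
  by rewrite eqrXn2 ?ltW// => /eqP.
have := ab n.+1; rewrite big_ord_recl big_ord_recr [RHS]big_ord_recl.
rewrite [X in _ = _ + X]big_ord_recr /= !subn0 subSS subnn.
rewrite -(IH 0%N)//.
have -> : \sum_(i < n) a (bump 0 i) * a (n.+1 - bump 0 i)%N =
          \sum_(i < n) b (bump 0 i) * b (n.+1 - bump 0 i)%N.
  apply: eq_bigr => i _; rewrite !IH//; rewrite /bump /= add1n ?ltnS//.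
  by rewrite subSS leq_subr.
move=> /eqP; rewrite addrCA [eqbRHS]addrCA => /eqP/addrI.
rewrite /bump leq0n add1n => aab; apply: (mulfI (lt0r_neq0 a0)); lra.
Qed.

(** * Identification of the law of [L] with a convolution semigroup *)

Section levy_semigroup.
Context {d : measure_display} {T : measurableType d} {R : realType}.
Context {P : probability T R} {L : R -> {RV P >-> R}}.
Context (levyL : levy_process L).
Context {G : R -> nat -> R}.
Context (GD : forall s h n, 0 < s -> 0 < h ->
  G (s + h) n = \sum_(i < n.+1) G s i * G h (n - i)%N).
Context (G_gt0 : forall s, 0 < s -> 0 < G s 0%N).

Let has_law (s : R) := nat_valued (L := L) s /\
  forall n, P (L s @^-1` [set n%:R]) = (G s n)%:E.

Lemma has_lawD (s h : R) : 0 < s -> 0 < h ->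
  has_law s -> has_law h -> has_law (s + h).
Proof.
move=> s0 h0 [Ns Ls] [Nh Lh]; split; first exact: (nat_valuedD levyL).
move=> n; rewrite (levy_convolution levyL)// GD// -sumEFin.
by apply: eq_bigr => i _; rewrite Ls Lh EFinM.
Qed.

(** The law of [L s] and [G s] are both convolution square roots of [G (s + s)] with positive
    constant term. *)
Lemma has_law_half (s : R) : 0 < s -> has_law (s + s) -> has_law s.
Proof.
move=> s0 [N2s L2s].
have [Ns Ps] : nat_valued (L := L) s /\ P (L s @^-1` [set 0]) != 0%E.
  apply: (nat_valued_half levyL) => //.
  by have := L2s 0%N; rewrite mulr0n => ->; rewrite eqe gt_eqF// G_gt0// addr_gt0.
split=> //.
pose p n := fine (P (L s @^-1` [set n%:R])).
have pE n : P (L s @^-1` [set n%:R]) = (p n)%:E.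
  by rewrite fineK// fin_num_measure//; exact: measurable_funPTI.
move=> n; rewrite pE; congr (_%:E); move: n.
apply: convolution_sqrt_unique; last 1 first.
- move=> n; rewrite -GD//; apply: EFin_inj; rewrite -L2s.
  rewrite (levy_convolution levyL)// -sumEFin.
  by apply: eq_bigr => i _; rewrite !pE EFinM.
- rewrite lt_neqAle eq_sym -eqe -pE mulr0n Ps/=.
  by rewrite -lee_fin -pE.
- exact: G_gt0.
Qed.

(** Halving from time 1 reaches [2^-j], adding reaches its multiples; [k.+1] keeps every time
    positive. *)
Lemma has_law_dyadic (j k : nat) : has_law 1 -> has_law (k.+1%:R * 2^-1 ^+ j).
Proof.
have p0 i : 0 < 2^-1 ^+ i :> R by rewrite exprn_gt0.
move=> H1; have Hj : has_law (2^-1 ^+ j).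
  elim: j => [|j IH]; first by rewrite expr0.
  apply: has_law_half => //.
  by rewrite (_ : _ + _ = 2^-1 ^+ j)// exprS; lra.
elim: k => [|k IH]; first by rewrite mul1r.
by rewrite -addn1 natrD mulrDl mul1r; apply: has_lawD => //; rewrite mulr_gt0.
Qed.

(* L is known at the dyadic times, and its law depends continuously on time. *)
Lemma levy_law_of_law1 (t : R) (n : nat) : 0 <= t ->
  nat_valued (L := L) 1 ->
  (forall k, P (L 1 @^-1` [set k%:R]) = (G 1 k)%:E) ->
  (G s n @[s --> t] --> G t n) ->
  P (L t @^-1` [set n%:R]) = (G t n)%:E.
Proof.
move=> t0 N1 L1 Gt.
have p0 i : 0 < 2^-1 ^+ i :> R by rewrite exprn_gt0.
(* Dyadic times approaching [t] from above, at distance at most [2^-j]; the successor keeps them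
   positive even for [t = 0]. *)
pose u (j : nat) : R := (Num.truncn (t * 2 ^+ j)).+1%:R * 2^-1 ^+ j.
have Hu j : has_law (u j) by apply: has_law_dyadic.
have ut : u @ \oo --> t.
  have c0 : (fun j => 2^-1 ^+ j : R) @ \oo --> (0 : R).
    by apply: cvg_expr; rewrite ger0_norm// invf_lt1// ltr1n.
  have c2 : (fun j => t + 2^-1 ^+ j) @ \oo --> t.
    by rewrite -[X in _ --> X]addr0; apply: cvgD c0; exact: cvg_cst.
  apply: squeeze_cvgr (cvg_cst t) c2; near=> j.
  have tE : t = t * 2 ^+ j * 2^-1 ^+ j by rewrite -mulrA -exprMn mulfV// expr1n mulr1.
  have T0 : 0 <= t * 2 ^+ j by rewrite mulr_ge0// exprn_ge0.
  have /andP[lo hi] := truncn_itv T0.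
  rewrite /u; apply/andP; split; first by rewrite [leLHS]tE ler_pM2r// ltW.
  rewrite [X in _ <= X + _]tE -[X in _ <= _ + X]mul1r -mulrDl ler_pM2r//.
  by rewrite -addn1 natrD lerD2r.
have Gu : (fun j => G (u j) n) @ \oo --> G t n.
  exact: (@cvg_comp _ _ _ u (fun s => G s n) _ _ _ ut Gt).
apply: (levy_law_limit levyL t (G t n) u (fun j => G (u j) n)) => // j.
- by rewrite mulr_ge0// ltW.
- by case: (Hu j).
- by case: (Hu j).
Unshelve. all: by end_near. Qed.

End levy_semigroup.

(** * The logarithmic law *)

(** The remainder vanishes at 0 and has derivative [x^n/(1-x)], which increases with [x]; the mean
    value theorem on [[0, a]] gives the bound. *)
Lemma log_series_tail (R : realType) (a : R) (n : nat) : 0 < a -> a < 1 ->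
  - ln (1 - a) - \sum_(k < n) a ^+ k.+1 / k.+1%:R <= a ^+ n / (1 - a).
Proof.
move=> a0 a1.
(* The term of index 0 vanishes because [0^-1 = 0]. *)
pose p : {poly R} := \poly_(k < n.+1) (k%:R^-1).
have pE x : p.[x] = \sum_(k < n) x ^+ k.+1 / k.+1%:R.
  rewrite horner_poly big_ord_recl invr0 mul0r add0r.
  by apply: eq_bigr => k _; rewrite mulrC.
pose f : R -> R := fun x => - ln (1 - x) - p.[x].
pose df : R -> R := fun x => x ^+ n / (1 - x).
have fdf (x : R) : x < 1 -> is_derive x 1 f (df x).
  move=> x1; have x1' : 0 < 1 - x by rewrite subr_gt0.
  have dln := is_derive1_ln x1'.
  have -> : df x = - ((1 - x)^-1 * - 1) - p^`().[x].
    have -> : p^`().[x] = \sum_(i < n) x ^+ i.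
      have -> : p^`() = \poly_(i < n) 1.
        apply/polyP => i; rewrite coef_deriv !coef_poly ltnS.
        by case: ifP => _; rewrite ?mul0rn// -[LHS]mulr_natr mulVf ?pnatr_eq0.
      by rewrite horner_poly; apply: eq_bigr => i _; rewrite mul1r.
    have := subrX1 x n; rewrite /df; move: (\sum_(i < n) _) => s xs.
    have -> : x ^+ n = 1 + (x - 1) * s by rewrite -xs; ring.
    by field; rewrite gt_eqF.
  have : is_derive x 1 (fun x => 1 - x) (- 1 : R).
    have := is_deriveB (is_derive_cst (1 : R) x 1) (is_derive_id x (1 : R)).
    by rewrite sub0r.
  move=> d1.
  have dc := @is_derive1_comp _ (@ln R) (fun z : R => 1 - z) x _ _ dln d1.
  have := is_deriveB (is_deriveN dc) (is_derive_poly p x).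
  by [].
have [||c /[!in_itv]/= /andP[c0 ca]] := @MVT_segment R f df 0 a (ltW a0).
- by move=> x /[!in_itv]/= /andP[_ xa]; apply: fdf; rewrite (lt_trans xa).
- apply: derivable_within_continuous => x /[!in_itv]/= /andP[_ xa].
  by have [] := fdf x (le_lt_trans xa a1).
rewrite {2}/f subr0 ln1 oppr0 sub0r pE big1 => [|k _]; last first.
  by rewrite expr0n mul0r.
rewrite oppr0 !subr0 !addr0 => fa; rewrite -pE -/(f a) fa /df.
have c1 : 0 < 1 - c by rewrite subr_gt0 (le_lt_trans ca).
apply: (@le_trans _ _ (c ^+ n / (1 - c))).
  by rewrite ler_piMr ?divr_ge0 ?exprn_ge0// ltW.
apply: ler_pM; rewrite ?exprn_ge0 ?invr_ge0 ?(ltW c1)//.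
  by rewrite lerXn2r ?nnegrE// ltW.
by rewrite lef_pV2 ?posrE// ?subr_gt0// lerD2l lerN2.
Qed.

Lemma oppr_ln1B_gt0 (R : realType) (a : R) : 0 < a -> a < 1 -> 0 < - ln (1 - a).
Proof.
by move=> a0 a1; rewrite oppr_gt0 ln_lt0// subr_gt0 a1/= ltrBlDr ltrDl.
Qed.

Lemma powR_exponent_continuous (R : realType) (b : R) : 0 < b ->
  continuous (fun s => b `^ s).
Proof.
move=> b0 t; rewrite /powR gt_eqF//.
apply: (@cvg_comp _ _ _ (fun s => s * ln b) expR); last exact: continuous_expR.
by apply: cvgMr_tmp; exact: cvg_id.
Qed.

Section bell_law.
Context {R : realType} {a b : R} {y : nat -> R}.
Context (b0 : 0 < b).

(** The coefficient of [X^n] in [b^s exp (s v(aX))], with [v] the series of [y]. *)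
Definition bell_law (s : R) (n : nat) : R :=
  b `^ s * a ^+ n * (egf_comp y exp_poly n).[s].

Lemma bell_lawD (s h : R) (n : nat) :
  bell_law (s + h) n = \sum_(i < n.+1) bell_law s i * bell_law h (n - i).
Proof.
rewrite /bell_law -egf_comp_expD powRD; last by apply/implyP => _; rewrite gt_eqF.
rewrite mulr_sumr; apply: eq_bigr => i _.
have -> : a ^+ n = a ^+ i * a ^+ (n - i) by rewrite -exprD subnKC// -ltnS.
ring.
Qed.

Lemma bell_law_gt0 (s : R) : 0 < bell_law s 0.
Proof.
rewrite /bell_law horner_egf_comp /egf_comp big_ord1 egf_pow0.
rewrite /exp_poly hornerZ hornerXn expr0 fact0 invr1 !mulr1 [_ *: _]mulr1.
by rewrite mulr1 powR_gt0.
Qed.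

Lemma bell_law_continuous (t : R) (n : nat) :
  bell_law s n @[s --> t] --> bell_law t n.
Proof.
apply: cvgM; last exact: continuous_horner.
by apply: cvgMr_tmp; exact: powR_exponent_continuous.
Qed.

End bell_law.

Lemma binomial_poly_at1 (R : realType) (k : nat) :
  (binomial_poly k).[1 : R] = (k <= 1)%:R.
Proof.
rewrite horner_binomial_poly /real_falling_factorial.
case: k => [|[|k]].
- by rewrite big_ord0 divr1.
- by rewrite big_ord1 subr0 divr1.
- by rewrite !big_ord_recl /= subrr mul0r mulr0 mul0r.
Qed.

(** At [t = 1] the binomial series [(1 + u)^t] is just [1 + u]. *)
Lemma egf_comp_binomial_at1 (R : realType) (c : nat -> R) (n : nat) :
  (egf_comp c binomial_poly n).[1] = egf_pow c 0 n + egf_pow c 1 n.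
Proof.
rewrite horner_egf_comp (@egf_comp_widen _ _ _ _ n.+1)// !big_ord_recl big1.
  by rewrite !binomial_poly_at1 addr0 [_ *: _]mulr1 [X in _ + X]mulr1.
by move=> i _; rewrite binomial_poly_at1 scaler0.
Qed.

(** The prescribed point masses already add up to 1, so no mass is left off the naturals. *)
Lemma log_law_nat_valued (R : realType) (alpha A : R)
  (alpha_gt0 : 0 < alpha) (alpha_lt1 : alpha < 1)
  (A_def : A = - ln (1 - alpha))
  (d : measure_display) (T : measurableType d) (P : probability T R)
  (X : {RV P >-> R})
  (law_X : forall k : nat,
     P (X @^-1` [set k%:R]) = (1 / A * (alpha ^+ k.+1 / k.+1%:R))%:E) :
  P (X @^-1` (~` natset)) = 0%E.
Proof.
have A0 : 0 < A by rewrite A_def oppr_ln1B_gt0.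
have mN : measurable (X @^-1` (~` natset)).
  by apply: measurable_funPTI; apply: measurableC; exact: measurable_natset.
have PE : P (X @^-1` (~` natset)) = (fine (P (X @^-1` (~` natset))))%:E.
  by rewrite fineK// fin_num_measure.
set q := fine _ in PE.
(* The mass off the naturals is at most the mass off [{0, ..., n-1}], which is a logarithmic series
   tail divided by [A]. *)
have q_le n : q <= alpha ^+ n / (1 - alpha) / A.
  pose F (i : nat) := X @^-1` [set i%:R].
  have mF i : measurable (F i) by exact: measurable_funPTI.
  have mU : measurable (\big[setU/set0]_(i < n) F i).
    by apply: bigsetU_measurable => i _; exact: mF.
  have PU : P (\big[setU/set0]_(i < n) F i) =
      (1 / A * \sum_(k < n) alpha ^+ k.+1 / k.+1%:R)%:E.
    rewrite (@measure_bigsetU_ord _ _ _ _ _ xpredT (fun i => F i))//.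
      rewrite mulr_sumr -sumEFin; apply: eq_bigr => i _; exact: law_X.
    apply/trivIsetP => i j _ _ /eqP ij; rewrite -subset0 => w [/= wi wj].
    by apply: ij; apply: val_inj; apply/eqP; rewrite -(eqr_nat R) -wi -wj.
  have PC : P (~` \big[setU/set0]_(i < n) F i) =
      (1 - 1 / A * \sum_(k < n) alpha ^+ k.+1 / k.+1%:R)%:E.
    by rewrite EFinB -PU; exact: probability_setC.
  have : (P (X @^-1` (~` natset)) <= P (~` \big[setU/set0]_(i < n) F i))%E.
    apply: le_measure; rewrite ?inE//; first exact: measurableC.
    move=> w /= wN; rewrite -bigcup_mkord => -[i _ Fi].
    by apply: wN; exists i.
  rewrite PE PC lee_fin => /le_trans; apply.
  rewrite ler_pdivlMr// mulrBl mul1r mul1r mulrAC mulVf ?gt_eqF// mul1r.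
  by rewrite A_def log_series_tail.
have q0 : q <= 0.
  have c0 : (fun n => alpha ^+ n / (1 - alpha) / A) @ \oo --> (0 : R).
    rewrite -[X in _ --> X](mul0r A^-1); apply: cvgMr_tmp.
    rewrite -[X in _ --> X](mul0r (1 - alpha)^-1); apply: cvgMr_tmp.
    by apply: cvg_expr; rewrite gtr0_norm.
  apply: (ler_cvg_to (cvg_cst q) c0); near=> n; exact: q_le.
apply/eqP; rewrite eq_le measure_ge0 andbT PE lee_fin//.
Unshelve. all: by end_near. Qed.

Theorem theorem1 (R : realType) (alpha A : R)
  (alpha_gt0 : 0 < alpha) (alpha_lt1 : alpha < 1)
  (A_def : A = - ln (1 - alpha))
  (d : measure_display) (T : measurableType d) (P : probability T R)
  (L : R -> {RV P >-> R}) (levyL : levy_process L)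
  (law_L1 : forall k : nat,
     P (L 1 @^-1` [set k%:R]) = (1 / A * (alpha ^+ k.+1 / k.+1%:R))%:E)
  (c y : nat -> R)
  (c_def : forall k : nat, (1 <= k)%N -> c k = k`!%:R / k.+1%:R)
  (y_def : forall n : nat, (1 <= n)%N ->
     y n = \sum_(1 <= k < n.+1)
             (-1) ^+ k.-1 * (k.-1)`!%:R * partial_bell n k c) :
  forall (t : R) (n : nat), 0 <= t ->
    P (L t @^-1` [set n%:R]) =
      ((alpha / A) `^ t * (alpha ^+ n / n`!%:R) *
       \sum_(0 <= k < n.+1) real_falling_factorial t k * partial_bell n k c)%:E
    /\
    P (L t @^-1` [set n%:R]) =
      ((alpha / A) `^ t * (alpha ^+ n / n`!%:R) *
       \sum_(0 <= k < n.+1) t ^+ k * partial_bell n k y)%:E.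
Proof.
move=> t n t0.
have A0 : 0 < A by rewrite A_def oppr_ln1B_gt0.
have b0 : 0 < alpha / A by rewrite divr_gt0.
have nf0 m : (m`!%:R : R) != 0 by rewrite pnatr_eq0 -lt0n fact_gt0.
have cy m : egf_comp c binomial_poly m = egf_comp y exp_poly m.
  by apply: egf_comp_binomial_exp => k k1; rewrite y_def// sum_log_partial_bell.
have Lt : P (L t @^-1` [set n%:R]) =
    (bell_law (a := alpha) (b := alpha / A) (y := y) t n)%:E.
  apply: (levy_law_of_law1 levyL _ _ t n t0).
  - by move=> s h m _ _; exact: bell_lawD.
  - by move=> s _; exact: bell_law_gt0.
  - exact: log_law_nat_valued law_L1.
  (* Since [c_j/j! = 1/(j+1)], [1 + u] is the sum of [X^j/(j+1)] over [j >= 0]; replacing [X] by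
     [alpha X] and multiplying by [alpha/A] gives the generating function of [L 1]. *)
  - move=> k; rewrite law_L1 /bell_law -cy egf_comp_binomial_at1 egf_pow0 egf_pow1.
    congr (_%:E); rewrite powRr1 ?(ltW b0)//.
    case: k => [|k] /=; first by rewrite addr0 expr0 expr1 !mulr1 divr1; ring.
    rewrite c_def// add0r.
    have -> : (k.+1)`!%:R / k.+2%:R / (k.+1)`!%:R = k.+2%:R^-1 :> R.
      by rewrite mulrAC divff// mul1r.
    by rewrite [alpha ^+ k.+2]exprS; ring.
  - exact: bell_law_continuous.
rewrite Lt (@sum_partial_bell _ c (real_falling_factorial t) binomial_poly t); last first.
  by move=> k; exact: horner_binomial_poly.
rewrite (@sum_partial_bell _ y (fun k => t ^+ k) exp_poly t); last first.
  by move=> k; rewrite /exp_poly hornerZ hornerXn mulrC.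
suff E : (alpha / A) `^ t * (alpha ^+ n / n`!%:R) *
    (n`!%:R * (egf_comp y exp_poly n).[t]) =
    bell_law (a := alpha) (b := alpha / A) (y := y) t n by rewrite cy E.
by rewrite /bell_law -!mulrA mulKf.
Qed.
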